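(* For every $x\in\mathbb{R}$ and every $y\ge b$, the value function $v$ satisfies $$x^+\le v(x,y)\le x^+ +\frac{c}{\rho},$$ where $x^+=\max(x,0)$.
   Context: Let $(\Omega,\mathcal F,\mathbb P)$ be a probability space with a complete right-continuous filtration $\mathbb F$. Fix constants $c,a,b,\eta,\rho>0$ and $\delta>1$. The claim sizes $(Y_k)_{k\ge1}$ are i.i.d. positive random variables with density $f$ and distribution function $F$, independent of the claim-counting process. For $y\ge b$, the claim-counting process $N=(N_t)_{t\ge0}$ is a Hawkes process with intensity $\lambda=(\lambda_t)_{t\ge 0}$ satisfying $d\lambda_t=a(b-\lambda_t)\,dt+\eta\,dN_t$, $\lambda_0=y$. The uncontrolled surplus is $R^x_t=x+ct-\sum_{k=1}^{N_t}Y_k$. A strategy is a pair $\alpha=(Z,K)$ (cumulative dividends, cumulative capital injections), and the controlled surplus is $X_t=R^x_t-Z_t+K_t$, with $X_{0^-}=x$. For $(x,y)\in\mathbb R\times[b,+\infty)$, the set $\mathcal A(x,y)$ of admissible strategies (for initial state $(X_0,\lambda_0)=(x,y)$) consists of those $\alpha$ such that: $Z$ is right-continuous with left limits, $\mathbb F$-adapted, non-decreasing, $Z_{0^-}=0$ and $Z_t-Z_{t^-}\le (X_{t^-}+R^0_t-R^0_{t^-})^+$ for all $t$; and $K$ is left-continuous with right limits, $\mathbb F$-adapted, non-decreasing, $K_{0^-}=0$. The ruin time is $T^\alpha=\inf\{t\ge0: X_{t^+}<0\}$. The reward and the value function are $$J_\alpha(x,y)=\mathbb E\Big[\int_0^{T^\alpha}e^{-\rho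 s}\,dZ_s-\delta\int_0^{T^\alpha}e^{-\rho s}\,dK_s\Big],\qquad v(x,y)=\sup_{\alpha\in\mathcal A(x,y)}J_\alpha(x,y),$$ where the integrals include lump-sum payments and injections made at time $0$. *)

(* Defs.v *)
From HB Require Import structures.
From mathcomp Require Import all_boot all_order all_algebra.
From mathcomp Require Import all_classical all_reals all_analysis.

Set Implicit Arguments.
Unset Strict Implicit.
Unset Printing Implicit Defensive.

Import Order.TTheory GRing.Theory Num.Theory.
Import numFieldNormedType.Exports.

Local Open Scope classical_set_scope.
Local Open Scope ring_scope.

(* Processes are maps [R -> T -> _] from time and scenario.  Only times t >= 0
   are meaningful; the values at t < 0 of N, Z and K are fixed to be their
   value at 0^-, so that "the left limit at 0" is the value at 0^-. *)

Section stochastic_basis.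
Context {R : realType} {d : measure_display} {T : measurableType d}.
Variable P : probability T R.
Implicit Types (FF : R -> set (set T)) (u : R -> T -> R) (N : R -> T -> nat).

Record filtration FF : Prop := {
  filtration_sigma_algebra : forall t, 0 <= t -> sigma_algebra setT (FF t);
  filtration_measurable : forall t, 0 <= t -> FF t `<=` measurable;
  filtration_le : forall s t, 0 <= s -> s <= t -> FF s `<=` FF t }.

(* [complete_filtration] covers both the completeness of the probability space
   and that of the filtration, since FF 0 consists of measurable sets. *)
Definition complete_filtration FF : Prop :=
  forall A : set T, P.-negligible A -> FF 0 A.

Definition right_continuous_filtration FF : Prop :=
  forall t, 0 <= t -> \bigcap_(s in [set s | t < s]) FF s = FF t.

Definition adapted FF u : Prop :=
  forall t, 0 <= t -> forall B : set R, measurable B -> FF t (u t @^-1` B).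

Definition cadlag (g : R -> R) : Prop :=
  (forall t, 0 <= t -> g s @[s --> t^'+] --> g t) /\
  (forall t, 0 <= t -> cvg (g s @[s --> t^'-])).

Definition caglad (g : R -> R) : Prop :=
  (forall t, 0 <= t -> g s @[s --> t^'-] --> g t) /\
  (forall t, 0 <= t -> cvg (g s @[s --> t^'+])).

Record martingale FF (M : R -> T -> R) : Prop := {
  martingale_adapted : adapted FF M;
  martingale_integrable :
    forall t, 0 <= t -> P.-integrable setT (fun w => (M t w)%:E);
  martingale_eq : forall s t (A : set T), 0 <= s -> s <= t -> FF s A ->
    (\int[P]_(w in A) (M t w)%:E = \int[P]_(w in A) (M s w)%:E)%E }.

Record counting_process N : Prop := {
  counting_neg : forall t w, t < 0 -> N t w = 0%N;
  counting_0 : forall w, N 0 w = 0%N;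
  counting_le : forall s t w, s <= t -> (N s w <= N t w)%N;
  counting_right_continuous :
    forall t w, 0 <= t -> \forall s \near t^'+, N s w = N t w;
  counting_unit_jumps :
    forall t w, 0 <= t -> \forall s \near t^'-, (N t w <= (N s w).+1)%N }.

(* lambda is an FF-intensity of N: the compensated process N_t - int_0^t lambda
   is an FF-local martingale, localised by the jump times tau_n of N.  As the
   jumps have size 1, N stopped at tau_n is min(N, n), and u <= tau_n is, up to
   one point u, the same as N_u < n. *)
Definition has_intensity FF N (lambda : R -> T -> R) : Prop :=
  forall n : nat, martingale FF (fun t w =>
    (minn (N t w) n)%:R -
    \int[lebesgue_measure]_(u in `[0, t]) (lambda u w * (N u w < n)%:R)).

Record hawkes_process FF (a b eta y : R) N (lambda : R -> T -> R) : Prop := {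
  hawkes_counting : counting_process N;
  hawkes_adapted : adapted FF (fun t w => (N t w)%:R);
  hawkes_intensity_adapted : adapted FF lambda;
  hawkes_intensity_right_continuous :
    forall w t, 0 <= t -> lambda s w @[s --> t^'+] --> lambda t w;
  hawkes_intensity_left_limit :
    forall w t, 0 < t -> cvg (lambda s w @[s --> t^'-]);
  hawkes_intensity : has_intensity FF N lambda;
  hawkes_sde : {ae P, forall w, forall t, 0 <= t ->
    lambda t w =
      y + \int[lebesgue_measure]_(u in `[0, t]) (a * (b - lambda u w))
      + eta * (N t w)%:R} }.

Definition mutually_independent (Y : nat -> {RV P >-> R}) : Prop :=
  forall (s : seq nat) (B : nat -> set R), uniq s ->
    (forall k, measurable (B k)) ->
    (P (\big[setI/setT]_(k <- s) (Y k @^-1` B k)) =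
     \prod_(k <- s) P (Y k @^-1` B k))%E.

Definition independent_sigma_algebras (G H : set (set T)) : Prop :=
  forall A B, G A -> H B -> (P (A `&` B) = P A * P B)%E.

Definition sigma_claims (Y : nat -> {RV P >-> R}) : set (set T) :=
  <<s [set A | exists k (B : set R), measurable B /\ A = Y k @^-1` B] >>.

Definition sigma_counting N : set (set T) :=
  <<s [set A | exists t (B : set nat), 0 <= t /\ A = N t @^-1` B] >>.

(* The claim Y_{k+1} of the usual numbering is [Y k]. *)
Record claim_sizes (f : R -> R) (Y : nat -> {RV P >-> R}) : Prop := {
  claims_density_ge0 : forall z, 0 <= f z;
  claims_density_measurable : measurable_fun setT f;
  claims_density : forall k (B : set R), measurable B ->
    (distribution P (Y k) B = \int[lebesgue_measure]_(z in B) (f z)%:E)%E;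
  claims_gt0 : forall k, {ae P, forall w, 0 < Y k w};
  claims_independent : mutually_independent Y }.

End stochastic_basis.

Section right_limit.
Context {R : realType}.

Definition right_limit (g : R -> R) (t : R) : R := lim (g s @[s --> t^'+]).

Variable g : R -> R.
Hypothesis g_nd : nondecreasing g.

Lemma right_limit_cvg t : g s @[s --> t^'+] --> right_limit g t.
Proof.
apply: nondecreasing_at_right_is_cvgr.
  by near=> z => p q _ _; exact: g_nd.
near=> z; exists (g t) => _ /= [p + <-].
by rewrite in_itv/= => /andP[/ltW tp _]; exact: g_nd.
Unshelve. all: by end_near. Qed.

Lemma right_limit_le t s : t < s -> right_limit g t <= g s.
Proof.
move=> ts; apply: limr_le; first exact: right_limit_cvg.
near=> z; apply: g_nd; apply: ltW.
by near: z; exact: nbhs_right_lt.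
Unshelve. all: by end_near. Qed.

Lemma right_limit_ge t : g t <= right_limit g t.
Proof.
apply: limr_ge; first exact: right_limit_cvg.
near=> z; apply: g_nd; apply: ltW.
by near: z; exact: nbhs_right_gt.
Unshelve. all: by end_near. Qed.

Lemma right_limit_nondecreasing : nondecreasing (right_limit g).
Proof.
move=> s t; rewrite le_eqVlt => /predU1P[->//|st].
exact: le_trans (right_limit_le st) (right_limit_ge t).
Qed.

Lemma right_limit_right_continuous : right_continuous (right_limit g).
Proof.
move=> t; apply/cvgrPdist_le => e e0.
have /cvgrPdist_le/(_ _ e0) gt := @right_limit_cvg t.
have [r tr gr] : exists2 r, t < r & `|right_limit g t - g r| <= e.
  near (t^'+)%R => r; exists r.
    by near: r; exact: nbhs_right_gt.
  by near: r.
near=> s.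
have ts : t < s by near: s; exact: nbhs_right_gt.
have sr : s < r by near: s; exact: nbhs_right_lt.
rewrite distrC ger0_norm ?subr_ge0; last exact/right_limit_nondecreasing/ltW.
move: gr; rewrite distrC; apply: le_trans.
apply: le_trans (ler_norm _).
by rewrite lerB// right_limit_le.
Unshelve. all: by end_near. Qed.

End right_limit.

Section optimal_dividends.
Context {R : realType} {d : measure_display} {T : measurableType d}.
Variable P : probability T R.
Variables (FF : R -> set (set T)) (c : R) (Y : nat -> {RV P >-> R}).
Variable N : R -> T -> nat.

Definition surplus (x t : R) (w : T) : R :=
  x + c * t - \sum_(0 <= k < N t w) Y k w.

Definition controlled_surplus (x : R) (Z K : R -> T -> R) (t : R) (w : T) : R :=
  surplus x t w - Z t w + K t w.

(* The set A(x,y); the dependence on y is through N.  By left continuity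
   K 0 = 0, and an injection at time 0 shows up as a positive right limit. *)
Record admissible_strategy (x : R) := {
  dividends : R -> T -> R;
  injections : R -> T -> R;
  dividends_neg : forall t w, t < 0 -> dividends t w = 0;
  dividends_nondecreasing : forall w, nondecreasing (dividends^~ w);
  dividends_cadlag : forall w, cadlag (dividends^~ w);
  dividends_adapted : adapted FF dividends;
  dividends_jump : forall t w, 0 <= t ->
    dividends t w - lim (dividends s w @[s --> t^'-]) <=
    Num.max 0
      (lim (controlled_surplus x dividends injections s w @[s --> t^'-])
       + surplus 0 t w - lim (surplus 0 s w @[s --> t^'-]));
  injections_neg : forall t w, t < 0 -> injections t w = 0;
  injections_nondecreasing : forall w, nondecreasing (injections^~ w);
  injections_caglad : forall w, caglad (injections^~ w);
  injections_adapted : adapted FF injections }.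

Section paths.
Variables (x : R) (alpha : admissible_strategy x) (w : T).

Definition dividends_path : R -> R := (dividends alpha)^~ w.

Lemma dividends_path_right_continuous : right_continuous dividends_path.
Proof.
move=> t; have [t0|t0] := leP 0 t; first exact: (dividends_cadlag alpha w).1.
rewrite {2}/dividends_path dividends_neg//.
apply: (@cvg_trans _ ((cst 0 : R -> R) @ t^'+)); last exact: cvg_cst.
apply: near_eq_cvg; near=> s; have s0 : s < 0 by near: s; exact: nbhs_right_lt.
by rewrite /dividends_path dividends_neg.
Unshelve. all: by end_near. Qed.

HB.instance Definition _ := isCumulative.Build R _ R dividends_path
  (dividends_nondecreasing alpha w) dividends_path_right_continuous.

(* dK for a left-continuous K is the Stieltjes measure of t |-> K_{t+}: its
   atom at t is K_{t+} - K_t. *)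
Definition injections_path : R -> R := right_limit ((injections alpha)^~ w).

HB.instance Definition _ := isCumulative.Build R _ R injections_path
  (right_limit_nondecreasing (injections_nondecreasing alpha w))
  (right_limit_right_continuous (injections_nondecreasing alpha w)).

Definition state (t : R) : R :=
  controlled_surplus x (dividends alpha) (injections alpha) t w.

Definition ruin_time : \bar R :=
  ereal_inf [set t%:E | t in [set t : R | 0 <= t /\ right_limit state t < 0]].

Definition until_ruin : set R := [set t | 0 <= t /\ (t%:E <= ruin_time)%E].

Definition discounted_dividends (rho : R) : \bar R :=
  (\int[lebesgue_stieltjes_measure dividends_path]_(s in until_ruin)
     (expR (- rho * s))%:E)%E.

Definition discounted_injections (rho : R) : \bar R :=
  (\int[lebesgue_stieltjes_measure injections_path]_(s in until_ruin)
     (expR (- rho * s))%:E)%E.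

End paths.

(* On \bar R, +oo - +oo = -oo: a scenario with infinite discounted injections
   has reward -oo. *)
Definition reward (rho delta x : R) (alpha : admissible_strategy x) : \bar R :=
  (\int[P]_w (discounted_dividends alpha w rho
              - delta%:E * discounted_injections alpha w rho))%E.

Definition value_function (rho delta x : R) : \bar R :=
  ereal_sup (range (@reward rho delta x)).

End optimal_dividends.

(* Main.v *)
Require Import Defs.
From HB Require Import structures.
From mathcomp Require Import all_boot all_order all_algebra.
From mathcomp Require Import all_classical all_reals all_analysis.
From mathcomp Require Import measurable_realfun.
From mathcomp Require Import ring.

Import Order.TTheory GRing.Theory Num.Theory.
Import numFieldNormedType.Exports.
Import HBNNSimple.

Local Open Scope classical_set_scope.
Local Open Scope ring_scope.

(** Lower bound: pay x^+ as a lump sum at time 0 and nothing afterwards, never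
    injecting.  The lump is allowed by the jump constraint and is collected
    even if ruin is immediate, since the ruin time belongs to the period over
    which dividends count ([value_function_ge]).

    Upper bound: the reward is bounded scenario by scenario.  Almost surely all
    claims are positive, so the uncontrolled surplus is at most x + c t.
    Solvency before ruin and the constraint on dividend jumps then give
      Z_t <= x^+ + c t + K_(t+)     for all t in [0, T]
    ([dividends_le_until_ruin]): a dividend that is not financed by the initial
    capital or by premiums is financed by an injection.  A bound on cumulative
    payments carries over to discounted payments because e^(- rho s) is the
    probability that an independent exponential time U of rate rho is at least
    s: by Tonelli, the discounted mass of a measure mu is the mean of
    mu [0, U] ([discounted_integralE]).  As E U = 1 / rho, discounted dividends
    are at most x^+ + c / rho plus discounted injections
    ([le_discounted_integral]), and injections are charged at a rate
    delta >= 1 ([pathwise_reward_le]).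

    The reward of a strategy is not known to be a measurable function of the
    scenario.  Both bounds integrate nevertheless, by the definition of the
    integral as a supremum over simple functions ([integral_ae_le_cst],
    [integral_ge_cst]). *)

(** * Integrals of arbitrary functions against a probability *)

Lemma integral_ae_le_cst {d : measure_display} {T : measurableType d}
    {R : realType} (P : probability T R) (f : T -> \bar R) (M : R) :
  0 <= M -> {ae P, forall w, (f w <= M%:E)%E} ->
  (\int[P]_w f w <= M%:E)%E.
Proof.
move=> M0 fM; rewrite integralE.
apply: (@le_trans _ _ (\int[P]_w f^\+ w)%E).
  by rewrite -[leRHS]sube0; apply: leeB => //; exact: integral_ge0.
rewrite ge0_integralTE//; apply: ge_ereal_sup => _ [h hf <-].
rewrite -integralT_nnsfun.
have <- : (\int[P]_w (cst M%:E) w = M%:E)%E.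
  by rewrite integral_cst// -[X in (_ * X)%E]/(P setT) probability_setT mule1.
apply: ae_ge0_le_integral => //.
- by move=> w _; rewrite lee_fin fun_ge0.
- exact/measurable_EFinP.
apply: filterS fM => w fw _; apply: le_trans (hf w) _.
by rewrite funeposE ge_max fw lee_fin.
Qed.

Lemma integral_ge_cst {d : measure_display} {T : measurableType d}
    {R : realType} (P : probability T R) (f : T -> \bar R) (k : R) :
  0 <= k -> (forall w, (k%:E <= f w)%E) -> (k%:E <= \int[P]_w f w)%E.
Proof.
move=> k0 kf.
have f0 w : (0 <= f w)%E by apply: le_trans (kf w); rewrite lee_fin.
rewrite ge0_integralTE//; apply: ereal_sup_ubound.
exists (cst_nnsfun T (NngNum k0)); first exact: kf.
rewrite -integralT_nnsfun; transitivity (\int[P]_w cst k%:E w)%E; first by [].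
by rewrite integral_cst// -[X in (_ * X)%E]/(P setT) probability_setT mule1.
Qed.

(** * Stieltjes measures of functions vanishing on negative times *)

(** The atom at 0 counts, because [0, t] is the decreasing intersection of the
    half-open intervals ]-1/(n+1), t], all of mass g t. *)
Lemma lebesgue_stieltjes_itv0 {R : realType} (g : cumulative R R) (t : R) :
  (forall s, s < 0 -> g s = 0) -> 0 <= t ->
  lebesgue_stieltjes_measure g `[0, t] = (g t)%:E.
Proof.
move=> g0 t0; pose I (n : nat) : set (measurableTypeR R) := `]- n.+1%:R^-1, t]%classic.
have Ilt n : - n.+1%:R^-1 < t :> R.
  by rewrite (lt_le_trans _ t0)// oppr_lt0 invr_gt0.
have muI n : lebesgue_stieltjes_measure g (I n) = (g t)%:E.
  rewrite /lebesgue_stieltjes_measure /measure_extension/= measurable_mu_extE/=; last first.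
    exact: is_ocitv.
  rewrite wlength_itv_bnd; last exact: ltW.
  by rewrite [g (- _)]g0 ?subr0// oppr_lt0 invr_gt0.
have capI : \bigcap_n I n = `[0, t]%classic.
  apply/seteqP; split => [s sI|s /=]; last first.
    rewrite in_itv/= => /andP[s0 st] n _; rewrite /I/= in_itv/= st andbT.
    by rewrite (lt_le_trans _ s0)// oppr_lt0 invr_gt0.
  have := sI 0%N Logic.I; rewrite /I/= !in_itv/= => /andP[_ ->]; rewrite andbT.
  rewrite leNgt; apply/negP => s0.
  have := sI (Num.truncn (- s)^-1) Logic.I; rewrite /I/= in_itv/= => /andP[+ _].
  rewrite ltNge => /negP; apply.
  rewrite lerNr -[leRHS]invrK lef_pV2 ?posrE ?invr_gt0 ?oppr_gt0//.
  by apply: ltW; exact: truncnS_gt.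
rewrite -capI.
have : lebesgue_stieltjes_measure g \o I @ \oo -->
    lebesgue_stieltjes_measure g (\bigcap_n I n).
  apply: (nonincreasing_cvg_mu (F := I)).
  - by rewrite [ltLHS]muI ltry.
  - by move=> n; exact: measurable_itv.
  - by rewrite capI; exact: measurable_itv.
  - move=> m n mn; apply/subsetPset => s; rewrite /I/= !in_itv/= => /andP[sn ->].
    rewrite andbT (le_lt_trans _ sn)// lerN2 lef_pV2 ?posrE// ler_nat//.
have -> : lebesgue_stieltjes_measure g \o I = cst (g t)%:E.
  by apply/funext => n; exact: muI.
by move=> /cvg_lim <-//; rewrite lim_cst.
Qed.

(** * Discounting as killing at an exponential time *)

Lemma continuous_discount {R : realType} (rho : R) :
  continuous (fun s : R^o => expR (- rho * s)).
Proof.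
move=> s; apply: continuous_comp; last exact: continuous_expR.
by apply: continuousM => //; apply: (@continuousN _ R^o); exact: cst_continuous.
Qed.

Lemma exponential_prob_ge {R : realType} (rho s : R) :
  0 < rho -> 0 <= s ->
  exponential_prob rho `[s, +oo[ = (expR (- rho * s))%:E.
Proof.
move=> rho0 s0; rewrite /exponential_prob.
rewrite (@ge0_continuous_FTC2y _ _ (fun z => - expR (- rho * z)) s 0).
- by rewrite EFinN oppeK add0e.
- by move=> z _; apply: exponential_pdf_ge0; exact: ltW.
- apply: (@continuous_subspaceW R^o _ _ [set` `[0, +oo[%R]).
    by apply: subset_itvr; rewrite bnd_simp.
  exact: within_continuous_exponential_pdf.
- rewrite -oppr0; apply: cvgN.
  rewrite (_ : (fun z => expR (- rho * z)) =
               (fun z => expR (- z)) \o (fun z => rho * z)); last first.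
    by apply: eq_fun => z; rewrite mulNr.
  apply: (@cvg_comp _ _ _ _ _ _ (pinfty_nbhs R)); last exact: cvgr_expR.
  exact: gt0_cvgMry.
- by move=> z _; exact: ex_derive.
- by apply: cvgN; apply/cvg_at_right_filter; exact: continuous_discount.
- move=> z; rewrite in_itv/= andbT => sz; apply: derive1_exponential_pdf.
  by rewrite in_itv/= andbT (le_lt_trans s0).
Qed.

Lemma measurable_discount {R : realType} (rho : R)
    (D : set (measurableTypeR R)) :
  measurable_fun D (fun s : R => (expR (- rho * s))%:E).
Proof.
apply: measurable_funTS; apply/measurable_EFinP.
apply: continuous_measurable_fun; exact: continuous_discount.
Qed.

Lemma nonneg_cut0 {R : realType} (D : set R) (u : R) :
  (forall s, D s -> 0 <= s) -> u < 0 -> D `&` `]-oo, u] = set0.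
Proof.
move=> D0 u0; apply/seteqP; split => s //= -[/D0 s0]; rewrite in_itv/= => su.
by have := le_lt_trans (le_trans s0 su) u0; rewrite ltxx.
Qed.

Section discounting.
Local Open Scope ereal_scope.
Context {R : realType} (rho : R).
Hypothesis rho_gt0 : (0 < rho)%R.

(** The law of the killing time.  Its probability structure depends on a proof
    that rho is positive, so it cannot be inferred and is named explicitly. *)
Definition killing : probability (measurableTypeR R) R :=
  exponential_distribution_exponential_prob__canonical__probability_measure_Probability
    rho_gt0.

Let measurable_killed (D : set (measurableTypeR R)) : measurable D ->
  measurable [set p : measurableTypeR R * measurableTypeR R |
    D p.1 /\ (p.1 <= p.2)%R].
Proof.
move=> mD.
have -> : [set p : measurableTypeR R * measurableTypeR R |
    D p.1 /\ (p.1 <= p.2)%R] = (fst @^-1` D) `&` [set p | (p.1 <= p.2)%R] by [].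
apply: measurableI.
  by rewrite -[X in measurable X]setTI; exact: measurable_fst.
have /(_ measurableT [set true] I) :=
  @measurable_fun_ler _ _ R setT _ _
    (@measurable_fst _ _ (measurableTypeR R) (measurableTypeR R))
    (@measurable_snd _ _ (measurableTypeR R) (measurableTypeR R)).
by rewrite setTI; congr measurable; apply/seteqP; split => p /=.
Qed.

Let ysection_killed (D : set R) (u : R) :
  ysection [set p : R * R | D p.1 /\ (p.1 <= p.2)%R] u = D `&` `]-oo, u].
Proof.
apply/seteqP; split => s; rewrite /ysection/= inE/= in_itv/= => -[Ds su];
by split.
Qed.

Lemma measurable_killed_mass
    (mu : {sigma_finite_measure set measurableTypeR R -> \bar R})
    (D : set (measurableTypeR R)) : measurable D ->
  measurable_fun [set: measurableTypeR R] (fun u => mu (D `&` `]-oo, u])).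
Proof.
move=> mD; under eq_fun do rewrite -ysection_killed.
exact: lebesgue_integral_fubini.measurable_fun_ysection (measurable_killed D mD).
Qed.

(** Both sides are the mass of {(s, u) | s in D, s <= u} under the product of mu
    and the law of the killing time, computed by slicing along s and along u. *)
Lemma discounted_integralE
    (mu : {sigma_finite_measure set measurableTypeR R -> \bar R})
    (D : set (measurableTypeR R)) :
  measurable D -> (forall s, D s -> (0 <= s)%R) ->
  \int[mu]_(s in D) (expR (- rho * s))%:E =
  \int[killing]_u mu (D `&` `]-oo, u]).
Proof.
move=> mD D0; under [RHS]eq_integral do rewrite -ysection_killed.
have mA := measurable_killed D mD.
rewrite -[RHS]/((mu \x^ killing) [set p : measurableTypeR R * measurableTypeR R |
    D p.1 /\ (p.1 <= p.2)%R]).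
rewrite -(@product_measure_unique _ _ _ _ _ mu killing (mu \x^ killing)%E) //; last first.
  move=> A B mA' mB'; exact: product_measure2E.
rewrite /product_measure1 integral_mkcond; apply: eq_integral => s _ /=.
rewrite patchE; case: ifPn => [/[!inE] Ds|/negP/[!inE] Ds].
  rewrite -(exponential_prob_ge rho s rho_gt0 (D0 _ Ds)); congr exponential_prob.
  apply/seteqP; split => u; rewrite /xsection/= in_itv/= andbT.
    by move=> su; apply/mem_set; split.
  by move=> /set_mem[].
rewrite (_ : xsection _ _ = set0) ?measure0//.
by apply/seteqP; split => u //; rewrite /xsection/= => /set_mem[].
Qed.

Lemma discounted_time :
  \int[lebesgue_measure]_(s in `[0%R, +oo[) (expR (- rho * s))%:E = (rho^-1)%:E :> \bar R.
Proof.
have := exponential_prob_ge rho 0 rho_gt0 (lexx 0%R).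
rewrite /exponential_prob mulr0 expR0 => h.
have : (rho%:E * \int[lebesgue_measure]_(s in `[0%R, +oo[) (expR (- rho * s))%:E = 1 :> \bar R).
  rewrite -ge0_integralZl//=.
  - rewrite -h; apply: eq_integral => s; rewrite inE/= in_itv/= andbT => s0.
    by rewrite exponential_pdfE.
  - exact: measurable_discount.
  - by rewrite lee_fin ltW.
move=> /(congr1 (fun z => (rho^-1)%:E * z)).
by rewrite muleA -EFinM mulVf ?gt_eqF// mul1e mule1.
Qed.

(** Cumulative domination is averaged over the killing time.  The term c u
    is c times the Lebesgue measure of [0, u], so that the mean killing time
    comes out of [discounted_integralE] and [discounted_time]. *)
Lemma le_discounted_integral
    (mu nu : {sigma_finite_measure set measurableTypeR R -> \bar R})
    (D : set (measurableTypeR R)) (k c : R) :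
  measurable D -> (forall s, D s -> (0 <= s)%R) -> (0 <= k)%R -> (0 <= c)%R ->
  (forall u, (0 <= u)%R ->
    mu (D `&` `]-oo, u]) <= (k + c * u)%:E + nu (D `&` `]-oo, u])) ->
  \int[mu]_(s in D) (expR (- rho * s))%:E <=
  (k + c / rho)%:E + \int[nu]_(s in D) (expR (- rho * s))%:E.
Proof.
move=> mD D0 k0 c0 munu.
pose leb : {sigma_finite_measure set measurableTypeR R -> \bar R} := lebesgue_measure.
have mH : measurable (`[0%R, +oo[ : set (measurableTypeR R)) by exact: measurable_itv.
have lebE u : (0 <= u)%R -> leb (`[0%R, +oo[ `&` `]-oo, u]) = u%:E.
  move=> u0; rewrite [X in leb X](_ : _ = `[0%R, u]%classic); last first.
    by apply/seteqP; split => s /=; rewrite !in_itv/= ?andbT => /andP.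
  rewrite /leb/=. rewrite lebesgue_measure_itv/= lte_fin sube0.
  by case: ltgtP u0 => // <-.
rewrite !discounted_integralE//.
have -> : (k + c / rho)%:E = \int[killing]_u (k%:E + c%:E * leb (`[0%R, +oo[ `&` `]-oo, u])).
  rewrite ge0_integralD//=.
  - rewrite integral_cst// -[X in _ * X + _]/(killing setT) probability_setT mule1.
    rewrite ge0_integralZl//.
    + rewrite -discounted_integralE//= ?discounted_time -?EFinM//.
      by move=> s; rewrite /= in_itv/= andbT.
    + exact: measurable_killed_mass.
  - by move=> u _; rewrite mule_ge0.
  - by apply: measurable_funeM; exact: measurable_killed_mass.
have mm : measurable_fun [set: measurableTypeR R]
    (fun u => k%:E + c%:E * leb (`[0%R, +oo[ `&` `]-oo, u])).
  apply: emeasurable_funD => //.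
  by apply: measurable_funeM; exact: measurable_killed_mass.
rewrite -ge0_integralD//=; first last.
- exact: measurable_killed_mass.
- by move=> u _; rewrite adde_ge0// mule_ge0.
apply: ge0_le_integral => //.
- exact: measurable_killed_mass.
- by apply: emeasurable_funD => //; exact: measurable_killed_mass.
move=> u _; have [u0|u0] := leP 0%R u.
  by rewrite lebE// -EFinM -EFinD munu.
by rewrite nonneg_cut0// !measure0 adde0 adde_ge0// mule_ge0.
Qed.

End discounting.

(** * Paths of the controlled surplus *)

(** An integer-valued nondecreasing function bounded by h t on the left of t
    attains there a largest value, and keeps it from then on. *)
Lemma nondecreasing_left_stationary {R : realType} (h : R -> nat) (t : R) :
  (forall s u, s <= u -> (h s <= h u)%N) ->
  exists2 n, (n <= h t)%N & \forall s \near t^'-, h s = n.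
Proof.
move=> h_nd.
have h_lt s : s < t -> (h s <= h t)%N by move=> /ltW; exact: h_nd.
pose A (n : nat) := `[< exists2 s, s < t & h s = n >].
have A0 : exists n, A n.
  by exists (h (t - 1)); apply/asboolP; exists (t - 1); rewrite ?ltrBlDr ?ltrDl.
have Ale n : A n -> (n <= h t)%N by move=> /asboolP[s st <-]; exact: h_lt.
have [n /asboolP[s st sn] n_max] := ex_maxnP A0 Ale.
exists n; first by rewrite -sn h_lt.
near=> u; apply/eqP; rewrite eqn_leq; apply/andP; split.
  by apply/n_max/asboolP; exists u => //; near: u; exact: nbhs_left_lt.
by rewrite -sn h_nd// ltW//; near: u; exact: nbhs_left_gt.
Unshelve. all: by end_near. Qed.

Section paths.
Context {R : realType} {d : measure_display} {T : measurableType d}.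
Context {P : probability T R} {FF : R -> set (set T)} {c : R}.
Context {Y : nat -> {RV P >-> R}} {N : R -> T -> nat}.
Hypothesis hN : counting_process N.

Lemma surplus_right_continuous (x t : R) (w : T) : 0 <= t ->
  surplus c Y N x s w @[s --> t^'+] --> surplus c Y N x t w.
Proof.
move=> t0.
have : (fun s => x + c * s - \sum_(0 <= k < N t w) Y k w) s @[s --> t^'+] -->
    surplus c Y N x t w.
  apply: cvgB; last exact: cvg_cst.
  apply: cvgD; first exact: cvg_cst.
  by apply: cvg_at_right_filter; apply: cvgM; [exact: cvg_cst|exact: cvg_id].
apply: cvg_trans; apply: near_eq_cvg.
by apply: filterS (counting_right_continuous hN w t0) => s; rewrite /surplus => ->.
Qed.

(** The limit is given in the form x + l with l independent of x, since the
    jump constraint on dividends compares the surpluses started from x and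
    from 0. *)
Lemma surplus_left_limit (t : R) (w : T) :
  exists l, forall x, surplus c Y N x s w @[s --> t^'-] --> x + l.
Proof.
have [n _ Nn] := @nondecreasing_left_stationary _ (N^~ w) t
  (fun s u => @counting_le _ _ _ _ hN s u w).
exists (c * t - \sum_(0 <= k < n) Y k w) => x.
have : (fun s => x + c * s - \sum_(0 <= k < n) Y k w) s @[s --> t^'-] -->
    x + (c * t - \sum_(0 <= k < n) Y k w).
  rewrite addrA; apply: cvgB; last exact: cvg_cst.
  apply: cvgD; first exact: cvg_cst.
  by apply: cvg_at_left_filter; apply: cvgM; [exact: cvg_cst|exact: cvg_id].
apply: cvg_trans; apply: near_eq_cvg.
by apply: filterS Nn => s; rewrite /surplus => ->.
Qed.

Lemma surplus_le {x t : R} {w : T} : (forall k, 0 < Y k w) ->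
  surplus c Y N x t w <= x + c * t.
Proof.
by move=> Y0; rewrite lerBlDr lerDl sumr_ge0// => k _; exact: ltW.
Qed.

Lemma surplusD (x t : R) (w : T) :
  surplus c Y N x t w = x + surplus c Y N 0 t w.
Proof. by rewrite /surplus add0r addrA. Qed.

Context {x : R} (alpha : admissible_strategy FF c Y N x) (w : T).
Notation Z := (dividends alpha).
Notation K := (injections alpha).

Lemma right_limit_state (t : R) : 0 <= t ->
  right_limit (state alpha w) t =
  surplus c Y N x t w - Z t w + injections_path alpha w t.
Proof.
move=> t0; apply/cvg_lim => //; apply: cvgD; last first.
  exact/right_limit_cvg/injections_nondecreasing.
apply: cvgB; first exact: surplus_right_continuous.
exact: (dividends_cadlag alpha w).1.
Qed.

(** The jump constraint at t, in cumulative form: with Z(t-) = z, the capital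
    X(t-) + R_t - R(t-) available for a lump payment equals R_t - z + K_t, as K
    is left-continuous. *)
Lemma dividends_le_left_limit {t : R} : 0 <= t ->
  Z t w <= Num.max (lim (Z s w @[s --> t^'-])) (surplus c Y N x t w + K t w).
Proof.
move=> t0; have := dividends_jump alpha w t0.
have [l hl] := surplus_left_limit t w.
have hZ := (dividends_cadlag alpha w).2 t t0.
set z := lim (Z s w @[s --> t^'-]).
have -> : lim (surplus c Y N 0 s w @[s --> t^'-]) = l.
  by apply/cvg_lim => //; rewrite -[X in _ --> X]add0r; exact: hl.
have -> : lim (controlled_surplus c Y N x Z K s w @[s --> t^'-]) =
    x + l - z + K t w.
  apply/cvg_lim => //; apply: cvgD.
    by apply: cvgB => //; exact: hl.
  exact: (injections_caglad alpha w).1.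
rewrite (surplusD x) lerBlDr addr_maxl add0r.
congr (_ <= Num.max _ _); ring.
Qed.

Lemma until_ruin_lt {s t : R} : until_ruin alpha w t -> 0 <= s -> s < t ->
  0 <= right_limit (state alpha w) s.
Proof.
move=> [_ tT] s0 st; rewrite leNgt; apply/negP => Xs.
have : (ruin_time alpha w <= s%:E)%E by apply: ereal_inf_lbound; exists s.
by move=> /(le_trans tT); rewrite lee_fin leNgt st.
Qed.

Lemma injections_path_ge0 (t : R) : 0 <= t -> 0 <= injections_path alpha w t.
Proof.
move=> t0; rewrite -(@injections_neg _ _ _ _ _ _ _ _ _ alpha (-1) w) ?ltrN10//.
apply: le_trans (right_limit_ge (injections_nondecreasing alpha w) t).
by apply: injections_nondecreasing; rewrite (le_trans _ t0)// lerN10.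
Qed.

(** At times s < T solvency reads Z_s <= R_s + K_(s+).  The ruin time itself is
    reached from the left: Z_t is at most the larger of Z(t-), which inherits
    the bound from the times before t, and R_t + K_t. *)
Lemma dividends_le_until_ruin (t : R) : 0 <= c -> (forall k, 0 < Y k w) ->
  until_ruin alpha w t ->
  Z t w <= Num.max x 0 + c * t + injections_path alpha w t.
Proof.
move=> c0 Y0 tT; have t0 := tT.1.
have K_nd := injections_nondecreasing alpha w.
have KK : K t w <= injections_path alpha w t := right_limit_ge K_nd t.
have surplus_le' s : s <= t -> surplus c Y N x s w <= Num.max x 0 + c * t.
  move=> st; apply: le_trans (surplus_le Y0) _.
  by rewrite lerD ?le_max ?lexx// ler_wpM2l.
apply: le_trans (dividends_le_left_limit t0) _.
rewrite ge_max lerD ?surplus_le'// andbT.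
apply: limr_le; first exact: (dividends_cadlag alpha w).2.
(* At t = 0 the left limit is that of Z on negative times, where Z vanishes. *)
move: t0; rewrite le_eqVlt => /predU1P[t0|t0].
  near=> s; rewrite dividends_neg; last first.
    by rewrite t0; near: s; exact: nbhs_left_lt.
  by rewrite addr_ge0 ?injections_path_ge0 -?t0// mulr0 addr0 le_max lexx orbT.
near=> s.
have s0 : 0 <= s by near: s; exact: nbhs_left_ge.
have st : s < t by near: s; exact: nbhs_left_lt.
have := until_ruin_lt tT s0 st; rewrite right_limit_state// addrAC subr_ge0.
move=> /le_trans; apply.
apply: lerD; first exact/surplus_le'/ltW.
exact: le_trans (right_limit_le K_nd st) KK.
Unshelve. all: by end_near. Qed.

(** The time t is the smaller of u and the ruin time. *)
Lemma until_ruin_cut (u : R) : 0 <= u ->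
  exists2 t, until_ruin alpha w t /\ t <= u &
    until_ruin alpha w `&` `]-oo, u] = `[0, t]%classic.
Proof.
move=> u0.
have T0 : (0 <= ruin_time alpha w)%E.
  by apply: le_ereal_inf_tmp => _ [s [s0 _] <-]; rewrite lee_fin.
have [uT|Tu] := leP u%:E (ruin_time alpha w).
  exists u => //; apply/seteqP; split => s /=; rewrite !in_itv/=.
    by move=> [[-> _] ->].
  move=> /andP[s0 su]; do 2?split => //.
  by apply: le_trans uT; rewrite lee_fin.
have Tfin : ruin_time alpha w \is a fin_num.
  by rewrite ge0_fin_numE// (lt_trans Tu) ?ltry.
have TE := fineK Tfin; set t := fine _ in TE.
have t0 : 0 <= t by exact: fine_ge0.
have tu : t <= u by rewrite -lee_fin TE ltW.
exists t; first by split => //; split => //; rewrite TE.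
rewrite /until_ruin -TE; apply/seteqP; split => s /=; rewrite !in_itv/= lee_fin.
  by move=> [[-> ->] _].
by move=> /andP[s0 st]; do 2?split => //; exact: le_trans tu.
Qed.

Lemma measurable_until_ruin :
  measurable (until_ruin alpha w : set (measurableTypeR R)).
Proof.
apply: is_interval_measurable => s t [s0 _] [_ tT] u /andP[su ut]; split.
  exact: le_trans su.
by apply: le_trans tT; rewrite lee_fin.
Qed.

End paths.

(** * Bounds on the value function *)

Section value_bounds.
Local Open Scope ereal_scope.
Context {R : realType} {d : measure_display} {T : measurableType d}.
Context {P : probability T R} {FF : R -> set (set T)} {c : R}.
Context {Y : nat -> {RV P >-> R}} {N : R -> T -> nat}.
Hypothesis hN : counting_process N.
Context {rho delta x : R}.
Hypothesis rho_gt0 : (0 < rho)%R.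

Lemma dividends_mass (alpha : admissible_strategy FF c Y N x) (w : T) (t : R) :
  (0 <= t)%R ->
  lebesgue_stieltjes_measure (dividends_path alpha w) `[0%R, t] =
  (dividends alpha t w)%:E.
Proof.
move=> t0; apply: lebesgue_stieltjes_itv0 => // s s0; exact: dividends_neg.
Qed.

Lemma injections_mass (alpha : admissible_strategy FF c Y N x) (w : T) (t : R) :
  (0 <= t)%R ->
  lebesgue_stieltjes_measure (injections_path alpha w) `[0%R, t] =
  (injections_path alpha w t)%:E.
Proof.
move=> t0; apply: lebesgue_stieltjes_itv0 => // s s0.
apply/eqP; rewrite eq_le; apply/andP; split.
  (* A right limit at s < 0 is bounded by the value at s / 2, still negative. *)
  rewrite -(injections_neg alpha w (t := (s / 2)%R)) ?pmulr_llt0//.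
  apply: right_limit_le; first exact: injections_nondecreasing.
  by rewrite ltr_nMr// invf_lt1// ltr1n.
rewrite -(injections_neg alpha w s0).
exact/right_limit_ge/injections_nondecreasing.
Qed.

Lemma pathwise_reward_le (alpha : admissible_strategy FF c Y N x) (w : T) :
  (0 <= c)%R -> (1 <= delta)%R -> (forall k, (0 < Y k w)%R) ->
  discounted_dividends alpha w rho - delta%:E * discounted_injections alpha w rho
    <= (Num.max x 0%R + c / rho)%:E.
Proof.
move=> c0 delta1 Y0.
have I0 : 0 <= discounted_injections alpha w rho.
  by apply: integral_ge0 => s _; rewrite lee_fin expR_ge0.
have D_le : discounted_dividends alpha w rho <=
    (Num.max x 0%R + c / rho)%:E + discounted_injections alpha w rho.
  apply: le_discounted_integral => //.
  - exact: measurable_until_ruin.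
  - by move=> s [].
  - by rewrite le_max lexx orbT.
  move=> u u0; have [t [tT tu] ->] := until_ruin_cut alpha w u u0.
  rewrite [leLHS]dividends_mass ?(proj1 tT)//.
  rewrite [X in _ + X]injections_mass ?(proj1 tT)// -EFinD lee_fin.
  apply: le_trans (dividends_le_until_ruin hN alpha w t c0 Y0 tT) _.
  by rewrite lerD2r lerD2l ler_wpM2l.
have [Ifin|] := boolP (discounted_injections alpha w rho \is a fin_num).
  rewrite leeBlDr ?fin_numM//; apply: le_trans D_le _; apply: leeD2l.
  by rewrite -[leLHS]mul1e; apply: lee_wpmul2r.
(* Infinite discounted injections make the reward -oo. *)
rewrite ge0_fin_numE// -leNgt leye_eq => /eqP ->.
by rewrite gt0_muley ?addeNy ?leNye// lte_fin (lt_le_trans ltr01).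
Qed.

Lemma value_function_le : (0 <= c)%R -> (1 <= delta)%R ->
  (forall k, {ae P, forall w, (0 < Y k w)%R}) ->
  value_function FF c Y N rho delta x <= (Num.max x 0%R + c / rho)%:E.
Proof.
move=> c0 delta1 Y0; apply: ge_ereal_sup => _ [alpha _ <-].
apply: integral_ae_le_cst.
  by rewrite addr_ge0 ?divr_ge0 ?(ltW rho_gt0)// le_max lexx orbT.
have : {ae P, forall w k, (0 < Y k w)%R} by exact/ae_foralln.
by apply: filterS => w; exact: pathwise_reward_le.
Qed.

Hypothesis hFF : filtration FF.

Definition pay_surplus_dividends (t : R) (w : T) : R :=
  if (0 <= t)%R then Num.max x 0%R else 0%R.

(** Deterministic processes are adapted: only set0 and setT occur as preimages. *)
Let adapted_cst (u : R -> T -> R) : (forall t w w', u t w = u t w') ->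
  adapted FF u.
Proof.
move=> u_cst t t0 B _.
have [FF0 FFC _] := filtration_sigma_algebra hFF t0.
have [[w Bw]|noB] := pselect (exists w, B (u t w)).
  rewrite (_ : _ @^-1` _ = setT `\` set0); first exact: FFC.
  by apply/seteqP; split => v /= _; [split => // -[]|rewrite (u_cst t v w)].
rewrite (_ : _ @^-1` _ = set0)//.
by apply/seteqP; split => v //= Bv; case: noB; exists v.
Qed.

Let pay_nd w : nondecreasing (pay_surplus_dividends^~ w).
Proof.
move=> s t st; rewrite /pay_surplus_dividends.
have [s0|s0] := leP 0%R s; first by rewrite (le_trans s0 st).
by case: ifP => // _; rewrite le_max lexx orbT.
Qed.

Let pay_left_limit t w : (0 <= t)%R ->
  pay_surplus_dividends s w @[s --> t^'-] -->
  (if (0 < t)%R then Num.max x 0%R else 0%R).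
Proof.
move=> t0; apply: (@cvg_trans _
  ((cst (if (0 < t)%R then Num.max x 0%R else 0%R) : R -> R) @ t^'-)); last exact: cvg_cst.
apply: near_eq_cvg; case: ltgtP t0 => // [t0|<-] _; near=> s.
  by rewrite /pay_surplus_dividends ifT//; near: s; exact: nbhs_left_ge.
rewrite /pay_surplus_dividends ifF//; apply/negbTE; rewrite -ltNge.
by near: s; exact: nbhs_left_lt.
Unshelve. all: by end_near. Qed.

Let pay_cadlag w : cadlag (pay_surplus_dividends^~ w).
Proof.
split=> t t0; last by apply/cvg_ex; eexists; exact: pay_left_limit.
apply: (@cvg_trans _ ((cst (Num.max x 0%R) : R -> R) @ t^'+)).
  apply: near_eq_cvg; near=> s; rewrite /pay_surplus_dividends/= ifT//.
  by rewrite (le_trans t0)//; near: s; exact: nbhs_right_ge.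
by rewrite /pay_surplus_dividends t0; exact: cvg_cst.
Unshelve. all: by end_near. Qed.

Let pay_jump t w : (0 <= t)%R ->
  (pay_surplus_dividends t w - lim (pay_surplus_dividends s w @[s --> t^'-]) <=
    Num.max 0
      (lim (controlled_surplus c Y N x pay_surplus_dividends (fun _ _ => 0)
             s w @[s --> t^'-])
       + surplus c Y N 0 t w - lim (surplus c Y N 0 s w @[s --> t^'-])))%R.
Proof.
move=> t0; have /cvg_lim -> // := pay_left_limit t w t0.
rewrite /pay_surplus_dividends t0.
case: ltgtP (t0) => // [tp|<-] _; first by rewrite subrr le_max lexx.
have [l hl] := @surplus_left_limit _ _ _ _ c Y _ hN 0%R w.
have -> : lim (surplus c Y N 0 s w @[s --> 0%R^'-]) = l.
  by apply/cvg_lim => //; rewrite -[X in _ --> X]add0r; exact: hl.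
have -> : lim (controlled_surplus c Y N x pay_surplus_dividends (fun _ _ => 0%R)
    s w @[s --> 0%R^'-]) = (x + l)%R.
  apply/cvg_lim => //; rewrite -[(x + l)%R]subr0 -[(_ - 0)%R]addr0.
  apply: cvgD; last exact: cvg_cst.
  apply: cvgB; first exact: hl.
  by have := @pay_left_limit 0%R w (lexx _); rewrite ltxx.
have -> : surplus c Y N 0 0 w = 0%R.
  by rewrite /surplus (counting_0 hN) big_geq// mulr0 addr0 subr0.
by rewrite subr0 addr0 addrK maxC.
Qed.

Let no_injections_caglad : caglad (fun _ : R => 0%R : R).
Proof. by split=> t _; [exact: cvg_cst|exact: is_cvg_cst]. Qed.

(** Transparent, so that its dividend and injection processes compute. *)
Definition pay_surplus : admissible_strategy FF c Y N x.
Proof.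
refine (@Build_admissible_strategy _ _ _ _ FF c Y N x pay_surplus_dividends
  (fun _ _ => 0%R) _ pay_nd pay_cadlag _ pay_jump _ _ _ _) => //.
- by move=> t w t0; rewrite /pay_surplus_dividends leNgt t0.
- exact: adapted_cst.
- by move=> _ s t _.
- exact: adapted_cst.
Defined.

Lemma discounted_injections_pay_surplus (w : T) :
  discounted_injections pay_surplus w rho = 0.
Proof.
rewrite /discounted_injections (discounted_integralE rho rho_gt0); last 2 first.
- exact: measurable_until_ruin.
- by move=> s [].
apply: integral0_eq => u _; have [u0|u0] := leP 0%R u.
  have [t [[t0 _] _] ->] := until_ruin_cut pay_surplus w u u0.
  rewrite [LHS]injections_mass//; congr EFin.
  exact: (@lim_cst R).
by rewrite nonneg_cut0 ?measure0// => s [].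
Qed.

Lemma discounted_dividends_pay_surplus (w : T) :
  (Num.max x 0%R)%:E <= discounted_dividends pay_surplus w rho.
Proof.
have T0 : until_ruin pay_surplus w 0%R.
  split => //; apply: le_ereal_inf_tmp => _ [s [s0 _] <-].
  by rewrite lee_fin.
pose mu := lebesgue_stieltjes_measure (dividends_path pay_surplus w).
(* Only the atom at time 0 is kept. *)
apply: (@le_trans _ _ (\int[mu]_(s in `[0%R, 0%R]) (expR (- rho * s))%:E)).
  rewrite (eq_integral (cst 1)); last first.
    by move=> s; rewrite inE/= in_itv/= -eq_le => /eqP <-; rewrite mulr0 expR0.
  rewrite integral_cst// mul1e /mu [leRHS]dividends_mass//.
  by rewrite /= /pay_surplus_dividends lexx.
apply: ge0_subset_integral => //.
- exact: measurable_until_ruin.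
- exact: measurable_discount.
- by move=> s; rewrite /= in_itv/= -eq_le => /eqP <-.
Qed.

Lemma value_function_ge :
  (Num.max x 0%R)%:E <= value_function FF c Y N rho delta x.
Proof.
apply: (@le_trans _ _ (reward rho delta pay_surplus)); last first.
  by apply: ereal_sup_ubound; exists pay_surplus.
apply: integral_ge_cst => [|w]; first by rewrite le_max lexx orbT.
rewrite discounted_injections_pay_surplus mule0 sube0.
exact: discounted_dividends_pay_surplus.
Qed.

End value_bounds.

Theorem mainTheorem1 (R : realType) (d : measure_display)
  (T : measurableType d) (P : probability T R)
  (FF : R -> set (set T))
  (hFF : filtration FF)
  (hFFcomplete : complete_filtration P FF)
  (hFFright : right_continuous_filtration FF)
  (c a b eta rho delta : R)
  (hc : 0 < c) (ha : 0 < a) (hb : 0 < b) (heta : 0 < eta) (hrho : 0 < rho)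
  (hdelta : 1 < delta)
  (f : R -> R) (Y : nat -> {RV P >-> R})
  (hY : claim_sizes f Y)
  (x y : R) (hy : b <= y)
  (N : R -> T -> nat) (lambda : R -> T -> R)
  (hN : hawkes_process P FF a b eta y N lambda)
  (hYN : independent_sigma_algebras P (sigma_claims Y) (sigma_counting N)) :
  ((Num.max x 0)%:E <= value_function FF c Y N rho delta x)%E /\
  (value_function FF c Y N rho delta x <= (Num.max x 0 + c / rho)%:E)%E.
Proof.
have hcount := hawkes_counting hN.
split; first exact: value_function_ge.
apply: value_function_le => //; [exact: ltW|exact: ltW|exact: claims_gt0 hY].
Qed.
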